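(* Let $d\ge 1$ be an integer and $E=\left\{\sum_{j=1}^\infty\varepsilon_j4^{-j} : \varepsilon_j\in\{0,1\}\right\}\subset\mathbb{R}$. In $\mathbb{R}^{d+1}=\mathbb{R}^d\times\mathbb{R}$ let $i=(0,\ldots,0,1)$ be the unit vector of the last coordinate axis, identify $E^d$ with $E^d\times\{0\}$, and identify $(2E)^d+i$ with $(2E)^d\times\{1\}$. Then the union $$B=\{(1-h)z+hz' : z\in E^d,\ z'\in(2E)^d+i,\ 0\le h\le1\}\subset\mathbb{R}^{d+1}$$ is a Besicovitch set in the following (wide) sense: $B$ has $(d+1)$-dimensional Lebesgue measure zero, and $B$ contains line segments in all directions belonging to some nonempty open set of directions of $\mathbb{R}^{d+1}$.
   Context: A Besicovitch set in the wide sense in $\mathbb{R}^n$ is a set of $n$-dimensional Lebesgue measure zero which contains (nondegenerate) line segments in all directions belonging to a nonempty open set of directions. Here $E^d$ denotes the $d$-fold Cartesian product of $E$. *)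

(* Defs.v *)
From mathcomp Require Import all_boot all_order all_algebra.
From mathcomp Require Import all_classical all_reals all_analysis.
Import Order.TTheory GRing.Theory Num.Theory numFieldNormedType.Exports.
Set Implicit Arguments.
Unset Strict Implicit.
Unset Printing Implicit Defensive.
Local Open Scope classical_set_scope.
Local Open Scope ring_scope.

Definition box (R : realType) (n : nat) (a b : 'rV[R]_n) : set 'rV[R]_n :=
  [set x | forall i, a 0 i <= x 0 i <= b 0 i].

(* Volume of [box a b] when [a 0 i <= b 0 i] for all [i]. *)
Definition box_volume (R : realType) (n : nat) (a b : 'rV[R]_n) : R :=
  \prod_(i < n) (b 0 i - a 0 i).

(* [c k] is the pair of extreme corners of the k-th box of the cover.
   Only meant for [0 < n]: there, finite covers are included because
   degenerate boxes have volume 0. *)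
Definition box_cover (R : realType) (n : nat) (A : set 'rV[R]_n)
    (c : nat -> 'rV[R]_n * 'rV[R]_n) : Prop :=
  (forall k i, (c k).1 0 i <= (c k).2 0 i) /\
  A `<=` \bigcup_k box (c k).1 (c k).2.

Definition lebesgue_outer (R : realType) (n : nat) (A : set 'rV[R]_n) : \bar R :=
  ereal_inf [set (\sum_(0 <= k <oo) (box_volume (c k).1 (c k).2)%:E)%E
            | c in box_cover A].

(* n-dimensional Lebesgue measure is the restriction of the outer measure to
   its Caratheodory-measurable sets. *)
Definition lebesgue_null (R : realType) (n : nat) (A : set 'rV[R]_n) : Prop :=
  caratheodory_measurable (@lebesgue_outer R n) A /\ lebesgue_outer A = 0%E.

(* Directions are represented by points of the Euclidean unit sphere; v and -v
   represent the same direction.  (The norm `|v| on 'rV[R]_n is the sup norm.) *)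
Definition unit_sphere (R : realType) (n : nat) : set 'rV[R]_n :=
  [set v | \sum_(i < n) v 0 i ^+ 2 = 1].

Definition open_directions (R : realType) (n : nat) (D : set 'rV[R]_n) : Prop :=
  exists2 U : set 'rV[R]_n, open U & D = U `&` @unit_sphere R n.

Definition contains_segment (R : realType) (n : nat) (B : set 'rV[R]_n)
    (v : 'rV[R]_n) : Prop :=
  exists (a : 'rV[R]_n) (l : R), 0 < l /\
    forall t : R, 0 <= t <= l -> B (a + t *: v).

Definition besicovitch_wide (R : realType) (n : nat) (B : set 'rV[R]_n) : Prop :=
  lebesgue_null B /\
  exists D : set 'rV[R]_n, [/\ open_directions D, D !=set0 &
    forall v, D v -> contains_segment B v].

Definition E4 (R : realType) : set R :=
  [set x | exists eps : nat -> bool,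
    (fun n : nat => \sum_(1 <= j < n.+1) (eps j)%:R * (4 ^- j : R))
      @ \oo --> x].

Definition cart_pow (R : realType) (d : nat) (A : set R) : set 'rV[R]_d :=
  [set z | forall i, A (z 0 i)].

(* The copy Z x {h} of Z in R^d x R. *)
Definition at_height (R : realType) (d : nat) (h : R) (Z : set 'rV[R]_d) :
  set 'rV[R]_(d + 1) := [set row_mx z (const_mx h : 'rV[R]_1) | z in Z].

Definition B4 (R : realType) (d : nat) : set 'rV[R]_(d + 1) :=
  [set x | exists (z z' : 'rV[R]_(d + 1)) (h : R), [/\ at_height 0 (cart_pow (@E4 R)) z,
    at_height 1 (cart_pow [set 2 * e | e in @E4 R]) z',
    0 <= h <= 1 & x = (1 - h) *: z + h *: z']].

(* Main.v *)
Require Import Defs.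
From mathcomp Require Import all_boot all_order all_algebra.
From mathcomp Require Import all_classical all_reals all_analysis.
From mathcomp Require Import ring lra zify.
Import Order.TTheory GRing.Theory Num.Theory numFieldNormedType.Exports.
Set Implicit Arguments.
Unset Strict Implicit.
Unset Printing Implicit Defensive.
Local Open Scope classical_set_scope.
Local Open Scope ring_scope.

(* Since 2E - E = [-1/3, 2/3], every direction (w, 1) with w in this cube is
   realised by a segment from E^d to (2E)^d + i.

   For measure zero it is enough to treat one coordinate, whose slice at height
   h is K_h = (1 - h)E + 2hE, the union of its 4^n cylinders (w + K_h) / 4^n,
   where w runs over the words of level n, i.e. the numbers a(1 - h) + 2hb with
   a, b integers having n base 4 digits in {0, 1}. If 2^p words of the same
   level are within distance p of each other (a "stack"), self-similarity gives
   |K_h| <= (2p + 1) / 2^p. On the other hand, for r, e > 0 every interval of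
   heights in [r, 1 - r] contains a subinterval, of relative length bounded below
   in terms of r and e, on which two distinct words of some level are e-close; taking e = 4^-n turns a stack of
   2^p words of level n into a stack of 2^(p+1) words. By porosity, a bound for
   the density of the area over the intervals carrying a stack of 2^(p+1) words
   is then also a bound over those carrying a stack of 2^p words, hence over all
   intervals in [r, 1 - r], and p and r are arbitrary. *)

(** * The Cantor set E *)

Section E4.
Variable R : realType.
Implicit Types (x y : R) (eps : nat -> bool).

Definition E4_sum eps (n : nat) : R :=
  \sum_(1 <= j < n.+1) (eps j)%:R * (4 ^- j : R).

Lemma E4_sumS eps n :
  E4_sum eps n.+1 = E4_sum eps n + (eps n.+1)%:R * 4 ^- n.+1.
Proof. by rewrite /E4_sum big_nat_recr. Qed.

Lemma E4_sum0 eps : E4_sum eps 0 = 0.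
Proof. by rewrite /E4_sum big_geq. Qed.

Lemma E4_sum_bounds eps n : 0 <= E4_sum eps n <= 3^-1 - 3^-1 * 4 ^- n.
Proof.
elim: n => [|n /andP[IH0 IH1]]; first by rewrite E4_sum0 expr0; lra.
have n4 : 0 < (4 ^- n : R) by rewrite invr_gt0 exprn_gt0.
have e01 : 0 <= ((eps n.+1)%:R : R) <= 1 by case: (eps _); rewrite /=; lra.
by rewrite E4_sumS exprS invfM; nra.
Qed.

Lemma E4_bounds x : E4 x -> 0 <= x <= 3^-1.
Proof.
move=> [eps epsx]; apply/andP; split.
- apply: (cvgr_to_ge epsx).
  by apply: nearW => n; have /andP[] := E4_sum_bounds eps n.
- apply: (cvgr_to_le epsx); apply: nearW => n.
  have /andP[_] := E4_sum_bounds eps n.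
  have : 0 < (4 ^- n : R) by rewrite invr_gt0 exprn_gt0.
  rewrite /E4_sum; lra.
Qed.

Lemma E4_sum_cvg eps : exists x, E4_sum eps @ \oo --> x.
Proof.
suff /cvg_ex : cvgn (E4_sum eps) by [].
apply: nondecreasing_is_cvgn.
  apply/nondecreasing_seqP => n; rewrite E4_sumS lerDl.
  by rewrite mulr_ge0 ?ler0n// invr_ge0 exprn_ge0.
exists 3^-1 => _ [n _ <-].
have /andP[_] := E4_sum_bounds eps n.
have : 0 < (4 ^- n : R) by rewrite invr_gt0 exprn_gt0.
lra.
Qed.

(** Multiplying by 4 brings the first digit in front of the point; the digit sequence shifted by one
    gives [y]. *)
Lemma E4_step x : E4 x -> exists (e : bool) (y : R), E4 y /\ 4 * x = e%:R + y.
Proof.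
move=> [eps epsx]; exists (eps 1%N), (4 * x - (eps 1%N)%:R); split; last by ring.
exists (eps \o S).
suff -> : (fun n : nat => \sum_(1 <= j < n.+1) ((eps \o S) j)%:R * (4 ^- j : R)) =
    (fun n => 4 * E4_sum eps n.+1 - (eps 1%N)%:R).
  apply: cvgB; last exact: cvg_cst.
  by apply: cvgMr; rewrite (cvg_shiftS (E4_sum eps)).
apply/funext => n; rewrite -[LHS]/(E4_sum (eps \o S) n).
elim: n => [|n IH]; first by rewrite E4_sumS !E4_sum0 expr1; field.
rewrite E4_sumS IH [in RHS]E4_sumS /= [in RHS]exprS.
by field; rewrite expf_neq0.
Qed.

(* Greedy base 4 expansion of x with digits 2 e' - e in {-1, 0, 1, 2}. *)
Lemma two_E4_minus_E4 x : - 3^-1 <= x <= 2 / 3 ->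
  exists u v, [/\ E4 u, E4 v & x = 2 * v - u].
Proof.
move=> x_bounds.
pose I : set R := [set t | - 3^-1 <= t <= 2 / 3].
(* The four intervals (I + k) / 4 with k = -1, 0, 1, 2 tile I; their common endpoints -1/12, 1/6 and
   5/12 are the thresholds used below. *)
have /choice [dig digP] : forall t : R, exists e : bool * bool,
    I t -> I (4 * t - (2 * e.2%:R - e.1%:R)).
  move=> t; have [t1|t1] := ltP t (- 3^-1 / 4).
    by exists (true, false); rewrite /I /=; lra.
  have [t2|t2] := ltP t (6^-1); first by exists (false, false); rewrite /I /=; lra.
  have [t3|t3] := ltP t (5 / 12); first by exists (true, true); rewrite /I /=; lra.
  by exists (false, true); rewrite /I /=; lra.
pose next t := 4 * t - (2 * (dig t).2%:R - (dig t).1%:R).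
(* Digits are numbered from 1, so digit [j] is read off the remainder left after [j - 1] steps. *)
pose e (k : bool * bool -> bool) j := k (dig (iter j.-1 next x)).
have IP n : I (iter n next x) by elim: n => [//|n IH] /=; exact: digP.
have xE n : x = 2 * E4_sum (e snd) n - E4_sum (e fst) n + iter n next x * 4 ^- n.
  elim: n => [|n IH]; first by rewrite !E4_sum0 expr0 /=; field.
  rewrite [LHS]IH !E4_sumS /e [iter n.+1 _ _]/= /next /= exprS.
  by field; rewrite expf_neq0.
have [u ucvg] := E4_sum_cvg (e fst); have [v vcvg] := E4_sum_cvg (e snd).
exists u, v; split; [by exists (e fst) | by exists (e snd) |].
have lim1 : 2 * E4_sum (e snd) n - E4_sum (e fst) n @[n --> \oo] --> 2 * v - u.
  by apply: cvgB => //; exact: cvgMr.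
suff lim2 : 2 * E4_sum (e snd) n - E4_sum (e fst) n @[n --> \oo] --> x.
  exact: (cvg_unique _ lim2 lim1).
have c4 : (4 ^- n : R) @[n --> \oo] --> (0 : R).
  under eq_fun do rewrite -exprVn.
  by apply: cvg_expr; rewrite ger0_norm; lra.
apply: (@squeeze_cvgr _ _ _ _ (fun n => x - 4 ^- n) (fun n => x + 4 ^- n)).
- apply: nearW => n; have := IP n; have := xE n; rewrite /I /=.
  have : 0 < (4 ^- n : R) by rewrite invr_gt0 exprn_gt0.
  move: (iter n next x) (_ - _) (4 ^- n) => t w q; nra.
- by rewrite -[X in _ --> X]subr0; apply: cvgB => //; exact: cvg_cst.
- by rewrite -[X in _ --> X]addr0; apply: cvgD => //; exact: cvg_cst.
Qed.

End E4.

(** * Words and slices *)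

Fixpoint E4_int (n : nat) : seq nat :=
  if n is m.+1 then [seq (4 * a + e)%N | a <- E4_int m, e <- [:: 0; 1]%N]
  else [:: 0%N].

Lemma E4_intS n a :
  reflect (exists2 b, b \in E4_int n & exists e : bool, a = (4 * b + e)%N)
          (a \in E4_int n.+1).
Proof.
apply: (iffP allpairsP) => [[[b e] /= [bn e01 ->]]|[b bn [e ->]]].
  exists b => //; move: e01; rewrite !inE => /orP[] /eqP->.
    by exists false.
  by exists true.
by exists (b, nat_of_bool e); split => //; case: e.
Qed.

Lemma E4_int_uniq n : uniq (E4_int n).
Proof.
elim: n => [//|n IH].
apply: (@allpairs_uniq _ _ _ (fun a e => 4 * a + e)%N) => //.
move=> _ _ /allpairsP[[a e] [_ e01 ->]] /allpairsP[[b f] [_ f01 ->]].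
move: e01 f01; rewrite /= !inE => /orP[] /eqP -> /orP[] /eqP -> ?; congr (_, _); lia.
Qed.

Lemma E4_int_size n : size (E4_int n) = (2 ^ n)%N.
Proof. by elim: n => [//|n IH]; rewrite size_allpairs IH expnSr. Qed.

(** The extreme case has all digits equal to 1, where a = (4^n - 1) / 3. *)
Lemma E4_int_lt n a : a \in E4_int n -> (3 * a < 4 ^ n)%N.
Proof.
elim: n a => [a|n IH a]; first by rewrite inE => /eqP->.
move=> /E4_intS[b /IH b3 [e ->]]; rewrite expnS; case: e; lia.
Qed.

Lemma E4_int_ltn n a : a \in E4_int n -> (a < 4 ^ n)%N.
Proof. by move/E4_int_lt; apply: leq_ltn_trans; rewrite leq_pmull. Qed.

Lemma digits_inj m a b a' b' : (b < m)%N -> (b' < m)%N ->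
  (a * m + b = a' * m + b')%N -> a = a' /\ b = b'.
Proof.
move=> bm b'm E.
have q c d : (d < m)%N -> ((c * m + d) %/ m = c)%N.
  by move=> dm; rewrite divnMDl ?(leq_ltn_trans _ dm)// divn_small ?addn0.
have aa : a = a' by rewrite -(q a b)// E q.
by split=> //; apply/eqP; rewrite -(eqn_add2l (a * m)) E aa.
Qed.

Lemma E4_int_cat m n a b : a \in E4_int m -> b \in E4_int n ->
  (a * 4 ^ n + b)%N \in E4_int (m + n).
Proof.
move=> am; elim: n b => [b|n IH b].
  by rewrite inE => /eqP->; rewrite muln1 !addn0.
move=> /E4_intS[c /IH cn [e ->]]; rewrite addnS.
by apply/E4_intS; exists (a * 4 ^ n + c)%N => //; exists e; rewrite expnS; lia.
Qed.

Lemma E4_int0 n : 0%N \in E4_int n.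
Proof.
by elim: n => [//|n IH]; apply/E4_intS; exists 0%N => //; exists false.
Qed.

Lemma E4_int_mono m n a : (n <= m)%N -> a \in E4_int n -> a \in E4_int m.
Proof.
by move=> /subnK <- an; have := E4_int_cat (E4_int0 (m - n)) an; rewrite mul0n.
Qed.

Lemma E4_int_shift n k a : a \in E4_int n -> (a * 4 ^ k)%N \in E4_int (n + k).
Proof. by move=> an; have := E4_int_cat an (E4_int0 k); rewrite addn0. Qed.

Definition words n : seq (nat * nat) := [seq (a, b) | a <- E4_int n, b <- E4_int n].

Lemma mem_words n w : (w \in words n) = (w.1 \in E4_int n) && (w.2 \in E4_int n).
Proof.
case: w => a b; apply/allpairsP/andP => [[[a' b'] /= [? ? [-> ->]]]//|[? ?]].
by exists (a, b).
Qed.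

Lemma words_uniq n : uniq (words n).
Proof. by apply: allpairs_uniq; rewrite ?E4_int_uniq // => -[a b] [c d]. Qed.

Lemma words_size n : size (words n) = (4 ^ n)%N.
Proof. by rewrite size_allpairs E4_int_size -expnMn. Qed.

Section slices.
Variable R : realType.
Implicit Types (h u : R) (w : nat * nat).

Definition slice h : set R :=
  [set u | exists x y, [/\ E4 x, E4 y & u = (1 - h) * x + h * (2 * y)]].

(** Left end of the cylinder of [w] at height [h], in units of 4^-n for a word of level n. It is
    affine in [h] with slope 2 b - a for w = (a, b). *)
Definition word_pos w h : R := w.1%:R * (1 - h) + w.2%:R * (2 * h).

Lemma slice_bounds h u : 0 <= h <= 1 -> slice h u -> 0 <= u <= 1.
Proof.
move=> h01 [x [y [/E4_bounds xb /E4_bounds yb ->]]].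
nra.
Qed.

Lemma E4_digits n (x : R) : E4 x ->
  exists (a : nat) (y : R), [/\ a \in E4_int n, E4 y & 4 ^+ n * x = a%:R + y].
Proof.
move=> xE; elim: n => [|n [a [y [an yE IH]]]].
  by exists 0%N, x; split => //; rewrite expr0 add0r mul1r.
have [e [z [zE yz]]] := E4_step yE; exists (4 * a + e)%N, z; split => //.
  by apply/E4_intS; exists a => //; exists e.
by rewrite exprS -mulrA IH mulrDr yz natrD natrM addrA.
Qed.

(** Self-similarity of K_h: cut the expansions of both points of E after [n] digits; the two tails
    form a point of the same slice. *)
Lemma slice_words n h u : slice h u ->
  exists (w : nat * nat) (v : R),
    [/\ w \in words n, slice h v & 4 ^+ n * u = word_pos w h + v].
Proof.
move=> [x [y [xE yE ->]]].
have [a [x' [an x'E xx']]] := E4_digits n xE.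
have [b [y' [bn y'E yy']]] := E4_digits n yE.
exists (a, b), ((1 - h) * x' + h * (2 * y')); split.
- by rewrite mem_words an bn.
- by exists x', y'.
- rewrite /word_pos /= mulrDr (mulrCA (4 ^+ n)) xx'.
  by rewrite (mulrCA (4 ^+ n)) (mulrCA (4 ^+ n)) yy'; ring.
Qed.

End slices.

(** * Heights at which two distinct words nearly coincide *)

Section close_words.
Variable R : realType.
Implicit Types (p q r x y : R).

Lemma E4_int_bounds n a : a \in E4_int n -> 0 <= (a%:R : R) <= 4 ^+ n / 3.
Proof.
move=> /E4_int_lt alt; have : ((3 * a)%:R : R) <= (4 ^ n)%:R.
  by rewrite ler_nat ltnW.
have : 0 <= (a%:R : R) by rewrite ler0n.
rewrite natrM natrX; lra.
Qed.

(** Expansion in base 4 with signed digits on [p] and [q]: an approximation of x / 4 scaled up by 4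
    has error at most 4 (p + q) / 3, which one more pair of digits brings back to (p + q) / 3. *)
Lemma greedy_digits p q n x : 0 < p -> 0 < q -> p <= 2 * q -> q <= 2 * p ->
  `|x| <= 4 ^+ n * ((p + q) / 3) ->
  exists a b c d : nat, [/\ all (mem (E4_int n)) [:: a; b; c; d] &
    `|x - (a%:R - b%:R) * p - (c%:R - d%:R) * q| <= (p + q) / 3].
Proof.
move=> p0 q0 pq qp; elim: n x => [|n IH] x xle.
  exists 0%N, 0%N, 0%N, 0%N; split => //.
  by rewrite !subrr !mul0r !subr0; rewrite expr0 mul1r in xle.
have /IH [a [b [c [d [/and5P[an bn cn dn _] le1]]]]] :
    `|x / 4| <= 4 ^+ n * ((p + q) / 3).
  by rewrite normrM (@ger0_norm _ 4^-1)//; rewrite exprS in xle; lra.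
(* The values -(p + q), -p, 0, p, p + q have gaps [p] or [q], each at most 2 (p + q) / 3 since the
   ratio of [p] and [q] is at most 2; so intervals of radius (p + q) / 3 around them leave no
   hole. *)
have digit (y : R) : `|y| <= 4 * ((p + q) / 3) -> exists e f e' f' : bool,
    `|y - (e%:R - f%:R) * p - (e'%:R - f'%:R) * q| <= (p + q) / 3.
  rewrite ler_norml => /andP[y1 y2].
  have [?|?] := leP y (- (2 * ((p + q) / 3))).
    by exists false, true, false, true; rewrite ler_norml /=; lra.
  have [?|?] := leP y (- ((p + q) / 3)).
    by exists false, true, false, false; rewrite ler_norml /=; lra.
  have [?|?] := leP y ((p + q) / 3).
    by exists false, false, false, false; rewrite ler_norml /=; lra.
  have [?|?] := leP y (2 * ((p + q) / 3)).
    by exists true, false, false, false; rewrite ler_norml /=; lra.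
  by exists true, false, true, false; rewrite ler_norml /=; lra.
have [|e [f [e' [f' le2]]]] :=
  digit (x - 4 * (a%:R - b%:R) * p - 4 * (c%:R - d%:R) * q).
  by move: le1; rewrite !ler_norml; lra.
exists (4 * a + e)%N, (4 * b + f)%N, (4 * c + e')%N, (4 * d + f')%N; split.
  by apply/and5P; split => //; apply/E4_intS;
    [exists a | exists b | exists c | exists d] => //; eexists.
have step (z : nat) (i : bool) : ((4 * z + i)%N%:R : R) = 4 * z%:R + i%:R.
  by rewrite natrD natrM.
by move: le2; rewrite !step; congr (_ <= _); congr (`|_|); ring.
Qed.

(** The least k with q <= 2 * 4^k p works: 4^k p <= 2 q follows from minimality, or from p <= q if k
    = 0, and then 4^k <= 2 q / p <= 4 / r. *)
Lemma balancing_power r p q : 0 < r -> r <= p -> p <= q -> q <= 2 ->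
  exists k : nat, [/\ 4 ^+ k * p <= 2 * q, q <= 2 * (4 ^+ k * p) & 4 ^+ k <= 4 / r].
Proof.
move=> r0 rp pq q2.
have ex : exists k : nat, q <= 2 * (4 ^+ k * p).
  have [k kP] : exists k : nat, 1 / p <= 4 ^+ k.
    exists (Num.bound (1 / p)); rewrite ltW//.
    apply: lt_le_trans (upper_nthrootP (leqnn _)) _.
    by rewrite lerXn2r ?nnegrE//; lra.
  exists k; move: kP; rewrite ler_pdivrMr; nra.
case: (ex_minnP ex) => k kP kmin; exists k.
have k2 : 4 ^+ k * p <= 2 * q.
  case: k kP kmin => [|k] kP kmin; first by rewrite expr0; lra.
  have := kmin k; case: (leP q (2 * (4 ^+ k * p))) => [_ /(_ isT)|? _].
    by rewrite ltnn.
  by rewrite exprS; lra.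
split => //; rewrite ler_pdivlMr//.
have : 0 < (4 ^+ k : R) by rewrite exprn_gt0.
nra.
Qed.

Lemma balanced_scales r p q : 0 < r -> r <= p <= 2 -> r <= q <= 2 ->
  exists k l : nat, [/\ 4 ^+ k * p <= 2 * (4 ^+ l * q),
    4 ^+ l * q <= 2 * (4 ^+ k * p), 4 ^+ k <= 4 / r & 4 ^+ l <= 4 / r].
Proof.
move=> r0 /andP[rp p2] /andP[rq q2].
have r4 : 1 <= 4 / r by rewrite ler_pdivlMr//; lra.
have [pq|/ltW qp] := leP p q.
  have [k [? ? ?]] := balancing_power r0 rp pq q2.
  by exists k, 0%N; rewrite expr0 mul1r.
have [k [? ? ?]] := balancing_power r0 rq qp p2.
by exists 0%N, k; rewrite expr0 mul1r.
Qed.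

(* After rescaling p and q by powers of 4 to comparable sizes, the leading terms
   4^n P - 4^n Q can be cancelled greedily by lower digits. *)
Lemma close_words_at r : 0 < r <= 1 -> exists K : R, 1 <= K /\
  forall p q (n : nat), r <= p <= 2 -> r <= q <= 2 ->
  exists (m : nat) (w w' : nat * nat),
  [/\ w \in words m, w' \in words m,
    `|(w.1%:R - w'.1%:R) * p + (w.2%:R - w'.2%:R) * q : R| <= K &
    (4 ^+ n : R) <= 2 * (w.2%:R - w'.2%:R) - (w.1%:R - w'.1%:R) <= K * 4 ^+ n].
Proof.
(* Both scaling powers are at most 4 / r, and the slope is at most 2 * 4/3 + 4/3 = 4 times this
   bound times 4^n. *)
move=> /andP[r0 r1]; exists (16 / r); split; first by rewrite ler_pdivlMr//; lra.
move=> p q n rp rq.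
have [k [l [PQ QP kr lr]]] := balanced_scales r0 rp rq.
have k1 : 1 <= (4 ^+ k : R) by rewrite exprn_ege1//; lra.
have l1 : 1 <= (4 ^+ l : R) by rewrite exprn_ege1//; lra.
have n1 : 1 <= (4 ^+ n : R) by rewrite exprn_ege1//; lra.
have -> : 16 / r = 4 * (4 / r) by ring.
move: kr lr; set K := 4 / r => kr lr.
set P := 4 ^+ k * p in PQ QP; set Q := 4 ^+ l * q in PQ QP.
have P0 : 0 < P by rewrite mulr_gt0; lra.
have Q0 : 0 < Q by rewrite mulr_gt0; lra.
have PK : P <= 2 * K by rewrite /P; nra.
have QK : Q <= 2 * K by rewrite /Q; nra.
have [|a [b [c [d [/and5P[an bn cn dn _] le1]]]]] :=
    @greedy_digits P Q n (4 ^+ n * (P - Q)) P0 Q0 PQ QP.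
  rewrite normrM (@ger0_norm _ (4 ^+ n)) ?exprn_ge0// ler_pM2l ?exprn_gt0//.
  by rewrite ler_norml; lra.
have E1 z : z \in E4_int n -> (4 ^ n + z)%N \in E4_int (1 + n).
  by move=> zn; rewrite -[(4 ^ n)%N]mul1n; exact: E4_int_cat.
have [m [mk ml]] : exists m, (1 + n + k <= m /\ 1 + n + l <= m)%N.
  exists (1 + n + k + l)%N; split; first exact: leq_addr.
  by rewrite [leqRHS]addnAC; exact: leq_addr.
have nk : (n + k <= m)%N by exact: ltnW.
have nl : (n + l <= m)%N by exact: ltnW.
have aw := E4_int_mono nk (E4_int_shift k an).
have bw := E4_int_mono mk (E4_int_shift k (E1 b bn)).
have cw := E4_int_mono ml (E4_int_shift l (E1 c cn)).
have dw := E4_int_mono nl (E4_int_shift l dn).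
(* The leading 4^n goes to the second word in the first coordinate and to the first word in the
   second. The position difference is then minus the greedy error, whereas in the slope the two
   leading terms add up. *)
exists m, ((a * 4 ^ k)%N, ((4 ^ n + c) * 4 ^ l)%N),
  (((4 ^ n + b) * 4 ^ k)%N, (d * 4 ^ l)%N).
have ab := E4_int_bounds an; have bb := E4_int_bounds bn.
have cb := E4_int_bounds cn; have db := E4_int_bounds dn.
split.
- by rewrite mem_words aw cw.
- by rewrite mem_words bw dw.
- rewrite /= !natrM !natrD !natrX.
  have -> : (a%:R * 4 ^+ k - (4 ^+ n + b%:R) * 4 ^+ k) * p +
    ((4 ^+ n + c%:R) * 4 ^+ l - d%:R * 4 ^+ l) * q =
    - (4 ^+ n * (P - Q) - (a%:R - b%:R) * P - (c%:R - d%:R) * Q).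
    by rewrite /P /Q; ring.
  by rewrite normrN; apply: le_trans le1 _; lra.
- rewrite /= !natrM !natrD !natrX.
  move: (4 ^+ n) (4 ^+ k) (4 ^+ l) n1 k1 l1 ab bb cb db kr lr => N U V.
  move=> n1 k1 l1 ab bb cb db kr lr {PQ QP P0 Q0 PK QK le1 an bn cn dn P Q}.
  move: (a%:R) (b%:R) (c%:R) (d%:R) ab bb cb db => a' b' c' d' ab bb cb db.
  have -> : 2 * ((N + c') * V - d' * V) - (a' * U - (N + b') * U) =
    2 * ((N + c' - d') * V) + (N + b' - a') * U by ring.
  have : 2 / 3 * N * V <= (N + c' - d') * V <= 4 / 3 * N * V.
    by rewrite !ler_pM2r//; lra.
  have : 2 / 3 * N * U <= (N + b' - a') * U <= 4 / 3 * N * U.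
    by rewrite !ler_pM2r//; lra.
  have : N <= N * V <= K * N by nra.
  have : N <= N * U <= K * N by nra.
  lra.
Qed.

Lemma word_posB (w w' : nat * nat) (h g : R) :
  word_pos w h - word_pos w' h = (word_pos w g - word_pos w' g) +
    (2 * (w.2%:R - w'.2%:R) - (w.1%:R - w'.1%:R)) * (h - g).
Proof. by rewrite /word_pos; ring. Qed.

(** At the midpoint [g] take two words at distance at most K whose positions separate at a rate [s]
    between 4^n and K 4^n. If 4^n is comparable to 1 / (y - x), they cross inside [x, y] and stay
    [e]-close on a fixed proportion of it. *)
Lemma close_words_porous r (e : R) : 0 < r <= 1 -> 0 < e ->
  exists k : R, 0 < k <= 1 /\ forall x y, r <= x -> x < y -> y <= 1 - r ->
  exists x' y', [/\ x <= x', x' <= y', y' <= y, k * (y - x) <= y' - x' &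
    exists m w w', [/\ w \in words m, w' \in words m, w != w' &
      forall h : R, x' <= h <= y' -> `|word_pos w h - word_pos w' h| <= e]].
Proof.
move=> r01 e0; have [K [K1 HK]] := close_words_at r01.
have K0 : 0 < K by lra.
(* With l the half-length of [x, y], the radius around the crossing is the smaller of l / 2 and e /
   (K 4^n); the choice of n gives l 4^n <= 8 K, so the latter is at least l e / (8 K^2). *)
exists (Num.min (1 / 2) (e / (8 * K ^+ 2))); split.
  have k0 : 0 < e / (8 * K ^+ 2) by rewrite divr_gt0// mulr_gt0// exprn_gt0.
  rewrite lt_min ge_min k0; apply/andP; split; first by apply/andP; split; lra.
  by apply/orP; left; lra.
move=> x y rx xy yr; set k := Num.min _ _.
have [k1 k2] : k <= 1 / 2 /\ k <= e / (8 * K ^+ 2).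
  by split; rewrite ge_min lexx ?orbT.
pose l := (y - x) / 2; pose g := (x + y) / 2.
have l0 : 0 < l by rewrite /l; lra.
have ex : exists n : nat, 2 * K <= l * 4 ^+ n.
  exists (Num.bound (2 * K / l)).
  rewrite [leRHS]mulrC -ler_pdivrMr// ltW//.
  apply: lt_le_trans (upper_nthrootP (leqnn _)) _.
  by rewrite lerXn2r ?nnegrE//; lra.
case: (ex_minnP ex) => n Kn nmin.
have nK : l * 4 ^+ n <= 8 * K.
  case: n Kn nmin => [|n] _ nmin; first by rewrite expr0 /l; lra.
  have := nmin n; case: (leP (2 * K) (l * 4 ^+ n)) => [_ /(_ isT)|? _].
    by rewrite ltnn.
  by rewrite exprS; lra.
have n0 : 0 < (4 ^+ n : R) by rewrite exprn_gt0.
have [||m [w [w' [wm w'm wK /andP[s1 s2]]]]] := HK (1 - g) (2 * g) n;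
  [by rewrite /g; lra | by rewrite /g; lra |].
set s := 2 * (_ - _) - _ in s1 s2.
have s0 : 0 < s by lra.
have posE h : word_pos w h - word_pos w' h =
    (word_pos w g - word_pos w' g) + s * (h - g) by exact: word_posB.
set c := word_pos w g - _ in posE.
have cK : `|c| <= K by move: wK; congr (`|_| <= _); rewrite /c /word_pos; ring.
(* [z] is the height where the two words coincide; it lies within l / 2 of [g] because |c| <= K and
   2 K <= l 4^n. *)
pose z := g - c / s.
have posEz h : word_pos w h - word_pos w' h = s * (h - z).
  by rewrite posE /z; field; rewrite gt_eqF.
have zg : `|c / s| <= l / 2.
  rewrite normrM normfV (gtr0_norm s0) ler_pdivrMr//; nra.
pose d := Num.min (l / 2) (e / (K * 4 ^+ n)).
have d0 : 0 < d.
  by rewrite lt_min; apply/andP; split; [lra | rewrite divr_gt0 ?mulr_gt0].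
have [d1 d2] : d <= l / 2 /\ d <= e / (K * 4 ^+ n).
  by split; rewrite ge_min lexx ?orbT.
have kd : k * l <= d.
  rewrite /d le_min; apply/andP; split; first by nra.
  rewrite ler_pdivlMr ?mulr_gt0//.
  move: k2; rewrite ler_pdivlMr ?mulr_gt0 ?exprn_gt0// expr2 => k2.
  have k0 : 0 <= k.
    by rewrite /k le_min; apply/andP; split; first lra;
      rewrite divr_ge0 ?mulr_ge0 ?exprn_ge0//; lra.
  apply: le_trans k2; have := ler_wpM2l (mulr_ge0 k0 (ltW K0)) nK; nra.
move: zg; rewrite ler_norml => zg.
exists (z - d), (z + d); split.
- by rewrite /z; move: zg d1; rewrite /g /l; lra.
- lra.
- by rewrite /z; move: zg d1; rewrite /g /l; lra.
- by move: kd; rewrite /l; lra.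
- exists m, w, w'; split => //.
    by apply/eqP => ww; move: s1 n0; rewrite /s ww; lra.
  move=> h hz; rewrite posEz normrM (gtr0_norm s0).
  have hd : `|h - z| <= d by rewrite ler_norml; lra.
  move: d2; rewrite ler_pdivlMr ?mulr_gt0// => d2.
  have := normr_ge0 (h - z); nra.
Qed.

End close_words.
(** * Covers of the slices *)

Section covers.
Variable R : realType.
Implicit Types (x y h u v e d : R).

(** A rectangle is encoded as its horizontal interval followed by its interval of heights. *)
Definition in_rect (r : R * R * (R * R)) u h : bool :=
  (r.1.1 <= u <= r.1.2) && (r.2.1 <= h <= r.2.2).

Definition rect_area (r : R * R * (R * R)) : R :=
  (r.1.2 - r.1.1) * (r.2.2 - r.2.1).

Definition proper_rect (r : R * R * (R * R)) : bool :=
  (r.1.1 <= r.1.2) && (r.2.1 <= r.2.2).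

Definition rect_cover x y v : Prop :=
  exists s : seq (R * R * (R * R)), [/\ all proper_rect s,
    forall h u, x <= h <= y -> slice h u -> exists2 r, r \in s & in_rect r u h &
    \sum_(r <- s) rect_area r <= v].

Lemma rect_cover_le x y v w : v <= w -> rect_cover x y v -> rect_cover x y w.
Proof. by move=> vw [s [? ? /le_trans sv]]; exists s; split => //; exact: sv. Qed.

Lemma rect_cover_cat x y z v w :
  rect_cover x y v -> rect_cover y z w -> rect_cover x z (v + w).
Proof.
move=> [s [sP sc sv]] [s' [sP' sc' sv']]; exists (s ++ s'); split.
- by rewrite all_cat sP.
- move=> h u /andP[xh hz] hu; have [hy|yh] := leP h y.
    have [|r rs ru] := sc h u _ hu; first by rewrite xh.
    by exists r => //; rewrite mem_cat rs.
  have [|r rs ru] := sc' h u _ hu; first by rewrite ltW.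
  by exists r => //; rewrite mem_cat rs orbT.
- by rewrite big_cat lerD.
Qed.

Lemma rect_cover_unit x y : 0 <= x -> x <= y -> y <= 1 -> rect_cover x y (y - x).
Proof.
move=> x0 xy y1; exists [:: ((0, 1), (x, y))]; split.
- by rewrite /= /proper_rect /= xy ler01.
- move=> h u hxy hu; exists ((0, 1), (x, y)); first by rewrite inE.
  by rewrite /in_rect/= hxy andbT; apply: slice_bounds hu; lra.
- by rewrite big_seq1 /rect_area /= subr0 mul1r.
Qed.

(** Area bounds add up over adjacent intervals of heights: cut [x, y] into pieces of length at most
    [d]. *)
Lemma rect_cover_local x y d (t : R) : 0 < d -> x <= y ->
  (forall x' y', x <= x' -> x' <= y' -> y' <= y -> y' - x' <= d ->
    rect_cover x' y' (t * (y' - x'))) ->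
  rect_cover x y (t * (y - x)).
Proof.
move=> d0 xy cov.
suff H k x' : x <= x' -> x' <= y -> y - x' <= k%:R * d ->
    rect_cover x' y (t * (y - x')).
  apply: (H (Num.bound ((y - x) / d))) => //.
  by rewrite -ler_pdivrMr// ltW// archi_boundP// divr_ge0; lra.
elim: k x' => [|k IH] x' xx' x'y.
  by rewrite mul0r => ?; apply: cov => //; lra.
rewrite -natr1 => yk; have [yd|yd] := leP (y - x') d; first by apply: cov.
have -> : t * (y - x') = t * ((x' + d) - x') + t * (y - (x' + d)) by ring.
by apply: rect_cover_cat; [apply: cov | apply: IH]; lra.
Qed.

(* A triple (a, b, l) encodes the strip a + b h <= u <= a + b h + l. *)
Definition strip_cover x y v : Prop :=
  exists s : seq (R * R * R), [/\ forall t, t \in s -> 0 <= t.2,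
    forall h u, x <= h <= y -> slice h u ->
      exists2 t, t \in s & t.1.1 + t.1.2 * h <= u <= t.1.1 + t.1.2 * h + t.2 &
    \sum_(t <- s) t.2 <= v].

(** Over heights of extent D, a strip of slope b and width l fits in a rectangle of width l + 2 |b|
    D; cutting the heights finely makes the total excess width at most [e]. *)
Lemma strip_rect_cover x y v e : x <= y -> 0 < e ->
  strip_cover x y v -> rect_cover x y ((v + e) * (y - x)).
Proof.
move=> xy e0 [s [s0 sc sv]]; pose S := \sum_(t <- s) `|t.1.2|.
have S0 : 0 <= S by apply: sumr_ge0.
pose d := e / (2 * (S + 1)).
have d0 : 0 < d by rewrite divr_gt0//; lra.
apply: (rect_cover_local d0 xy) => x' y' xx' xy' yy' dxy.
set D := y' - x' in dxy *; have D0 : 0 <= D by rewrite /D; lra.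
pose f (t : R * R * R) := ((t.1.1 + t.1.2 * x' - `|t.1.2| * D,
  t.1.1 + t.1.2 * x' + t.2 + `|t.1.2| * D), (x', y')).
exists (map f s); split.
- apply/allP => _ /mapP[t ts ->]; rewrite /proper_rect/= xy' andbT.
  have := s0 t ts; have := mulr_ge0 (normr_ge0 t.1.2) D0; lra.
- move=> h u /andP[xh hy] /sc[|t ts tu]; first by apply/andP; split; lra.
  exists (f t); first exact: map_f.
  rewrite /in_rect/= xh hy !andbT.
  have : `|t.1.2 * (h - x')| <= `|t.1.2| * D.
    by rewrite normrM ler_wpM2l// ger0_norm; rewrite /D; lra.
  by rewrite ler_norml; lra.
- rewrite big_map.
  have -> : \sum_(t <- s) rect_area (f t) =
      (\sum_(t <- s) t.2) * D + 2 * D * S * D.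
    rewrite /S mulr_sumr !mulr_suml -big_split/=; apply: eq_bigr => t _.
    by rewrite /rect_area /= -/D; ring.
  rewrite -mulrDl ler_wpM2r// lerD//.
  move: dxy; rewrite /d ler_pdivlMr; nra.
Qed.

(** All positions are within [p] of a common centre [c], so on heights in [0, 1] the cylinders,
    which fit in unit intervals at this scale, lie in an interval of length 2 p + 1. *)
Definition stack (p : nat) x y : Prop :=
  exists (n : nat) (s : seq (nat * nat)) (c : nat * nat),
  [/\ uniq s, size s = (2 ^ p)%N, {subset s <= words n} &
    forall w h, w \in s -> x <= h <= y -> `|word_pos w h - word_pos c h| <= p%:R].

Lemma stack0 x y : stack 0 x y.
Proof.
exists 0%N, [:: (0, 0)%N], (0, 0)%N; split => // w h.
by rewrite inE => /eqP-> _; rewrite subrr normr0.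
Qed.

Lemma size_words_diff n (s : seq (nat * nat)) : uniq s -> {subset s <= words n} ->
  (size [seq w <- words n | w \notin s] + size s = 4 ^ n)%N.
Proof.
move=> us ss; rewrite -words_size -(count_predC (mem s) (words n)) addnC.
rewrite size_filter; congr (_ + _)%N; rewrite -size_filter.
apply/perm_size/uniq_perm; rewrite ?filter_uniq ?words_uniq// => w.
by rewrite mem_filter/=; case: (boolP (w \in s)) => // /ss ->.
Qed.

(* The cylinders of a stack lie in a single strip; the other cylinders of the
   same level are scaled copies of the whole set. *)
Lemma stack_strip_cover p x y e : 0 <= x -> x <= y -> y <= 1 -> 0 < e ->
  stack p x y -> strip_cover x y ((2 * p%:R + 1) / 2 ^+ p + e).
Proof.
move=> x0 xy y1 e0 [n [s [c [us szs ss sP]]]].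
have n0 : 0 < (4 ^+ n : R) by rewrite exprn_gt0.
have p0 : 0 < (2 ^+ p : R) by rewrite exprn_gt0.
have pp : 0 <= (p%:R : R) by [].
set rest := [seq w <- words n | w \notin s].
have szrest : (size rest)%:R + 2 ^+ p = 4 ^+ n :> R.
  by rewrite -!natrX -natrD -szs size_words_diff.
pose q : R := 1 - 2 ^+ p / 4 ^+ n.
have q01 : 0 <= q < 1.
  have : 0 <= ((size rest)%:R : R) by [].
  rewrite /q ltrBlDr ltrDl divr_gt0// subr_ge0 ler_pdivrMr// mul1r; lra.
(* One refinement turns a bound v into (2 p + 1) / 4^n + q v. Since 1 - q = 2^p / 4^n, the fixed
   point is (2 p + 1) / 2^p, and the error shrinks by the factor [q]. *)
suff H r : strip_cover x y ((2 * p%:R + 1) / 2 ^+ p + q ^+ r).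
  have qr : q ^+ r @[r --> \oo] --> (0 : R).
    by apply: cvg_expr; rewrite ger0_norm; lra.
  have [r qre] : exists r : nat, q ^+ r <= e by apply: filter_ex (cvgr_le 0 qr e e0).
  have [l [l0 lc lv]] := H r; exists l; split => //.
  by apply: le_trans lv _; rewrite lerD2l.
elim: r => [|r [l [l0 lc lv]]].
  exists [:: (0, 0, 1)]; split.
  - by move=> t; rewrite inE => /eqP ->.
  - move=> h u hxy hu; exists (0, 0, 1); first by rewrite inE.
    by rewrite /= mul0r !add0r; apply: slice_bounds hu; lra.
  - by rewrite big_seq1/= expr0 lerDr divr_ge0//; lra.
pose f (w : nat * nat) (t : R * R * R) : R * R * R :=
  ((w.1%:R + t.1.1) / 4 ^+ n, (2 * w.2%:R - w.1%:R + t.1.2) / 4 ^+ n, t.2 / 4 ^+ n).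
pose t0 : R * R * R :=
  ((c.1%:R - p%:R) / 4 ^+ n, (2 * c.2%:R - c.1%:R) / 4 ^+ n,
   (2 * p%:R + 1) / 4 ^+ n).
exists (t0 :: [seq f w t | w <- rest, t <- l]); split.
- move=> t; rewrite inE => /orP[/eqP->|/allpairsP[[w t'] /= [_ /l0 t'0 ->]]].
    by rewrite /= divr_ge0//; lra.
  by rewrite /= divr_ge0//; lra.
- move=> h u hxy /(slice_words n)[w [v [wn hv uE]]].
  have {uE} -> : u = (word_pos w h + v) / 4 ^+ n by rewrite -uE; field; rewrite gt_eqF.
  have [ws|ws] := boolP (w \in s).
    exists t0; first by rewrite inE eqxx.
    have := sP w h ws hxy; rewrite ler_norml => wc.
    have v01 : 0 <= v <= 1 by apply: slice_bounds hv; lra.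
    rewrite /t0/= (mulrAC _ _ h) -!mulrDl !ler_pM2r ?invr_gt0//.
    by move: wc; rewrite /word_pos; lra.
  have [t tl tv] := lc h v hxy hv; exists (f w t).
    rewrite inE; apply/orP; right; apply/allpairsP; exists (w, t); split => //=.
    by rewrite mem_filter ws.
  rewrite /f/= (mulrAC _ _ h) -!mulrDl !ler_pM2r ?invr_gt0//.
  by move: tv; rewrite /word_pos; lra.
- rewrite big_cons big_allpairs_dep/=.
  have -> : \sum_(w <- rest) \sum_(t <- l) (f w t).2 =
      q * \sum_(t <- l) t.2.
    under eq_bigr do rewrite /f/= -mulr_suml.
    rewrite big_const_seq count_predT iter_addr_0.
    have -> : q = (size rest)%:R / 4 ^+ n.
      by rewrite /q -szrest; field; rewrite szrest gt_eqF.
    by rewrite -mulr_natl; ring.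
  have qv := ler_wpM2l (andP q01).1 lv.
  apply: (le_trans (lerD (lexx _) qv)).
  rewrite exprS mulrDr addrA lerD2r /q le_eqVlt; apply/orP; left.
  by apply/eqP; field; rewrite !gt_eqF.
Qed.

(* If w and w' are so close that they differ by at most one unit of level m + n,
   then w and w' each followed by the words of the stack form one stack. *)
Lemma stackS p r x y : 0 < r <= 1 -> stack p x y ->
  exists k : R, 0 < k <= 1 /\ forall x1 y1, r <= x1 -> x <= x1 -> x1 < y1 ->
    y1 <= y -> y1 <= 1 - r ->
  exists x' y', [/\ x1 <= x', x' <= y', y' <= y1, k * (y1 - x1) <= y' - x' &
    stack p.+1 x' y'].
Proof.
move=> r01 [n [s [c [us szs ss sP]]]].
have n0 : 0 < (4 ^+ n : R) by rewrite exprn_gt0.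
have ni0 : 0 < (4 ^- n : R) by rewrite invr_gt0.
have [k [k01 HK]] := close_words_porous r01 ni0.
exists k; split => // x1 y1 rx1 xx1 xy1 yy1 y1r.
have [x' [y' [x1x' x'y' y'y1 kxy [m [v [v' [vm v'm vv' vclose]]]]]]] :=
  HK x1 y1 rx1 xy1 y1r.
exists x', y'; split => //.
(* Concatenation: the digits of [v] followed by those of [w]. *)
pose f (w v : nat * nat) := ((v.1 * 4 ^ n + w.1)%N, (v.2 * 4 ^ n + w.2)%N).
have fpos w z h : word_pos (f w z) h = 4 ^+ n * word_pos z h + word_pos w h :> R.
  by rewrite /word_pos /f/= !natrD !natrM !natrX; ring.
have ltw w : w \in s -> (w.1 < 4 ^ n)%N && (w.2 < 4 ^ n)%N.
  by move=> /ss; rewrite mem_words => /andP[/E4_int_ltn -> /E4_int_ltn ->].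
have finj w z w' z' : w \in s -> w' \in s -> f w z = f w' z' -> w = w' /\ z = z'.
  move=> /ltw/andP[w1 w2] /ltw/andP[w'1 w'2] [].
  move=> /(digits_inj w1 w'1)[z1 ww1] /(digits_inj w2 w'2)[z2 ww2].
  by split; [case: w w' ww1 ww2 {w1 w2 w'1 w'2} => ? ? [? ?]
    | case: z z' z1 z2 => ? ? [? ?]] => /= -> ->.
(* Relative to the centre [f c v], words beginning with [v] stay within [p]; those beginning with
   [v'] are displaced by at most 1 more, hence p + 1. *)
exists (m + n)%N, ([seq f w v | w <- s] ++ [seq f w v' | w <- s]), (f c v); split.
- rewrite cat_uniq !map_inj_in_uniq ?us ?andbT/=.
  + apply/hasPn => _ /mapP[w ws ->]; apply/negP => /mapP[w' w's].
    by move=> /(finj _ _ _ _ ws w's)[_ /eqP]; rewrite eq_sym (negPf vv').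
  + by move=> w w' ws w's /(finj _ _ _ _ ws w's)[].
  + by move=> w w' ws w's /(finj _ _ _ _ ws w's)[].
- by rewrite size_cat !size_map szs addnn expnS mul2n.
- move=> z; rewrite mem_cat mem_words => /orP[] /mapP[w /ss].
    rewrite mem_words => /andP[w1 w2] ->.
    by move: vm; rewrite mem_words => /andP[v1 v2]; rewrite !E4_int_cat.
  rewrite mem_words => /andP[w1 w2] ->.
  by move: v'm; rewrite mem_words => /andP[v1 v2]; rewrite !E4_int_cat.
- move=> z h zw /andP[x'h hy'].
  have hxy : x <= h <= y by lra.
  move: zw; rewrite mem_cat => /orP[] /mapP[w ws ->]; rewrite !fpos.
    have := sP w h ws hxy; rewrite -[p.+1%:R]natr1 !ler_norml; lra.
  have := sP w h ws hxy; rewrite -[p.+1%:R]natr1 !ler_norml.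
  have : `|4 ^+ n * (word_pos v h - word_pos v' h)| <= 1.
    rewrite normrM (gtr0_norm n0) -ler_pdivlMl// mulr1.
    by apply: vclose; rewrite x'h.
  by rewrite ler_norml mulrBr; move: (4 ^+ n * _) (4 ^+ n * _) => a b; lra.
Qed.

(** Start from the unit-width cover. Each round takes out a subinterval of proportion at least [k]
    with density [t] and recurses on both sides, so the excess density shrinks by the factor 1 -
    k. *)
Lemma rect_cover_porous k x y (t : R) : 0 < k <= 1 -> 0 <= x -> x <= y -> y <= 1 -> 0 <= t ->
  (forall x1 y1, x <= x1 -> x1 < y1 -> y1 <= y ->
    exists x' y', [/\ x1 <= x', x' <= y', y' <= y1, k * (y1 - x1) <= y' - x' &
      rect_cover x' y' (t * (y' - x'))]) ->
  forall e, 0 < e -> rect_cover x y ((t + e) * (y - x)).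
Proof.
move=> k01 x0 xy y1 t0 por.
suff H n x' y' : x <= x' -> x' <= y' -> y' <= y ->
    rect_cover x' y' ((t + (1 - k) ^+ n) * (y' - x')).
  move=> e e0; have [n ne] : exists n : nat, (1 - k) ^+ n <= e.
    have kn : (1 - k) ^+ n @[n --> \oo] --> (0 : R).
      by apply: cvg_expr; rewrite ger0_norm; lra.
    exact: filter_ex (cvgr_le 0 kn e e0).
  apply: rect_cover_le (H n x y (lexx _) xy (lexx _)).
  by rewrite ler_wpM2r ?lerD2l//; lra.
elim: n x' y' => [|n IH] x' y' xx' x'y' y'y.
  have : rect_cover x' y' (y' - x') by apply: rect_cover_unit => //; lra.
  by apply: rect_cover_le; rewrite expr0; nra.
move: x'y'; rewrite le_eqVlt => /orP[/eqP x'y'|x'y'].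
  have := @rect_cover_unit x' y'; rewrite -x'y' subrr mulr0.
  by apply; lra.
have [x2 [y2 [x'x2 x2y2 y2y' kxy cov]]] := por x' y' xx' x'y' y'y.
have c1 : rect_cover x' x2 ((t + (1 - k) ^+ n) * (x2 - x')) by apply: IH; lra.
have c3 : rect_cover y2 y' ((t + (1 - k) ^+ n) * (y' - y2)) by apply: IH; lra.
apply: rect_cover_le (rect_cover_cat (rect_cover_cat c1 cov) c3).
have : 0 <= (1 - k) ^+ n by rewrite exprn_ge0//; lra.
rewrite exprS; move: ((1 - k) ^+ n) => z z0.
have := ler_wpM2l z0 kxy; lra.
Qed.

(** Descent on [P]: inside an interval carrying a stack of order P, those carrying one of order P +
    1 are porous, so the density bound passes down to order 0, where every interval qualifies. *)
Lemma stack_rect_cover r P (t : R) : 0 < r <= 1 -> 0 <= t ->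
  (forall x y, r <= x -> x <= y -> y <= 1 - r -> stack P x y ->
    forall e, 0 < e -> rect_cover x y ((t + e) * (y - x))) ->
  forall x y, r <= x -> x <= y -> y <= 1 - r ->
    forall e, 0 < e -> rect_cover x y ((t + e) * (y - x)).
Proof.
move=> r01 t0; elim: P => [|P IH] HP.
  by move=> x y rx xy yr; apply: HP => //; exact: stack0.
apply: IH => x y rx xy yr /(stackS r01)[k [k01 kP]] e e0.
have -> : t + e = (t + e / 2) + e / 2 by field.
apply: (@rect_cover_porous k) => //; [lra | lra | lra | | lra].
move=> x1 y1 xx1 xy1 yy1.
have [||x' [y' [? ? ? ? st]]] := kP x1 y1 _ xx1 xy1 yy1; [lra | lra |].
by exists x', y'; split => //; apply: HP => //; lra.
Qed.

(** The two end pieces, of height at most e / 4, are covered trivially; the middle piece costs at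
    most e / 6 + e / 6. *)
Lemma rect_cover_null e : 0 < e -> rect_cover 0 1 e.
Proof.
move=> e0; pose r := Num.min (1 / 2) (e / 4).
have r0 : 0 < r by rewrite lt_min; apply/andP; split; lra.
have [r1 r2] : r <= 1 / 2 /\ r <= e / 4 by split; rewrite ge_min lexx ?orbT.
have c1 : rect_cover 0 r (r - 0) by apply: rect_cover_unit; lra.
have c3 : rect_cover (1 - r) 1 (1 - (1 - r)) by apply: rect_cover_unit; lra.
have [p pe] : exists p : nat, (2 * p%:R + 1) / 2 ^+ p <= e / 6.
  have [n ne] : exists n : nat, 24 / e <= n%:R :> R.
    by exists (Num.bound (24 / e)); rewrite ltW// archi_boundP// divr_ge0//; lra.
  (* Here 2^p is the square of 2^n >= n + 1: one factor is at least 24 / e, and four times the other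
     exceeds 4 n + 1. *)
  exists (n * 2)%N; rewrite exprM ler_pdivrMr ?exprn_gt0// natrM expr2.
  have n2 : n%:R + 1 <= 2 ^+ n :> R by rewrite natr1 -natrX ler_nat ltn_expl.
  move: ne; rewrite ler_pdivrMr// => ne.
  have en : 4 <= e / 6 * 2 ^+ n.
    by have := ler_wpM2l (ltW e0) n2; lra.
  have n0 : 0 <= (n%:R : R) by [].
  have n1 : 0 <= (2 ^+ n : R) by rewrite exprn_ge0.
  by have := ler_wpM2r n1 en; lra.
have t0 : 0 <= (2 * p%:R + 1) / 2 ^+ p :> R by rewrite divr_ge0 ?exprn_ge0.
have c2 : rect_cover r (1 - r) (((2 * p%:R + 1) / 2 ^+ p + e / 6) * (1 - r - r)).
  apply: (@stack_rect_cover r p) => //; try lra.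
  move=> x y rx xy yr st d d0.
  have -> : forall z, z + d = (z + d / 2) + d / 2 by move=> z; field.
  apply: strip_rect_cover; rewrite ?divr_gt0//.
  by apply: stack_strip_cover; rewrite ?divr_gt0//; lra.
apply: rect_cover_le (rect_cover_cat (rect_cover_cat c1 c2) c3).
nra.
Qed.

End covers.

(** * Null sets in R^n *)

Section lebesgue_outer.
Variables (R : realType) (n : nat).
Implicit Types (A X Y : set 'rV[R]_n) (c : nat -> 'rV[R]_n * 'rV[R]_n).

Lemma box_volume_ge0 (a b : 'rV[R]_n) :
  (forall i, a 0 i <= b 0 i) -> 0 <= box_volume a b.
Proof. by move=> ab; apply: prodr_ge0 => i _; rewrite subr_ge0. Qed.

Lemma lebesgue_outer_ge0 A : (0 <= lebesgue_outer A)%E.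
Proof.
apply/ereal_infP => _ [c [cle _] <-].
by apply: nneseries_ge0 => k _ _; rewrite lee_fin box_volume_ge0.
Qed.

Lemma le_lebesgue_outer X Y : X `<=` Y -> (lebesgue_outer X <= lebesgue_outer Y)%E.
Proof.
move=> XY; apply/ereal_infP => _ [c [cle cY] <-]; apply: ereal_inf_lbound.
by exists c => //; split => //; exact: subset_trans cY.
Qed.

Definition finite_box_cover A (e : R) : Prop :=
  exists s : seq ('rV[R]_n * 'rV[R]_n),
  [/\ forall b i, b \in s -> b.1 0 i <= b.2 0 i,
    forall x, A x -> exists2 b, b \in s & box b.1 b.2 x &
    \sum_(b <- s) box_volume b.1 b.2 <= e].

Lemma lebesgue_outerU_finite A X (e : R) : finite_box_cover A e ->
  (lebesgue_outer (A `|` X) <= e%:E + lebesgue_outer X)%E.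
Proof.
move=> [s [sle sA se]]; rewrite -leeBlDl//.
apply/ereal_infP => _ [c [cle cX] <-]; rewrite leeBlDl//.
pose m := size s.
pose d k := if (k < m)%N then nth (0, 0) s k else c (k - m)%N.
have dle k i : (d k).1 0 i <= (d k).2 0 i.
  by rewrite /d; case: ifP => // km; apply: sle; exact: mem_nth.
apply: (@le_trans _ _ (\sum_(0 <= k <oo) (box_volume (d k).1 (d k).2)%:E)%E).
  apply: ereal_inf_lbound; exists d => //; split => // x [/sA[b bs bx]|/cX[k _ kx]].
    exists (index b s) => //.
    by rewrite /d index_mem bs nth_index.
  by exists (k + m)%N => //; rewrite /d ltnNge leq_addl/= addnK.
rewrite (nneseries_split 0 m); last by move=> k _; rewrite lee_fin box_volume_ge0.
rewrite add0n; apply: leeD.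
  rewrite sumEFin lee_fin; apply: le_trans se.
  rewrite [leRHS](big_nth (0, 0)) le_eqVlt; apply/orP; left; apply/eqP.
  by apply: eq_big_nat => k /andP[_ km]; rewrite /d km.
rewrite -nneseries_addn; last by move=> k; rewrite lee_fin box_volume_ge0.
apply: lee_nneseries => k _; first by rewrite lee_fin box_volume_ge0.
by rewrite /d ltnNge leq_addl/= addnK.
Qed.

Lemma lebesgue_outer0 : (0 < n)%N -> lebesgue_outer (@set0 'rV[R]_n) = 0%E.
Proof.
move=> n0; apply/eqP; rewrite eq_le lebesgue_outer_ge0 andbT.
apply: ereal_inf_lbound; exists (fun=> (0, 0)); first by split => // k i.
apply: eseries0 => k _ _; rewrite /box_volume.
by rewrite (bigD1 (Ordinal n0))//= subrr mul0r.
Qed.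

(** Adjoining [A] to a set does not increase its outer measure; applied to the empty set this gives
    measure 0, and applied to X minus [A] it gives the Caratheodory identity. *)
Lemma lebesgue_null_finite A : (0 < n)%N ->
  (forall e, 0 < e -> finite_box_cover A e) -> lebesgue_null A.
Proof.
move=> n0 Ae.
have AU X : (lebesgue_outer (A `|` X) <= lebesgue_outer X)%E.
  apply/lee_addgt0Pr => e e0; rewrite addeC.
  exact/lebesgue_outerU_finite/Ae.
have A0 : lebesgue_outer A = 0%E.
  apply/eqP; rewrite eq_le lebesgue_outer_ge0 andbT -(lebesgue_outer0 n0).
  by rewrite -{1}(setU0 A) AU.
split => // X.
have -> : lebesgue_outer (X `&` A) = 0%E.
  apply/eqP; rewrite eq_le lebesgue_outer_ge0 andbT -A0.
  by apply: le_lebesgue_outer; exact: subIsetr.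
rewrite add0r; apply/eqP; rewrite eq_le; apply/andP; split.
  apply: le_trans (AU _); apply: le_lebesgue_outer => x Xx.
  by have [Ax|nAx] := pselect (A x); [left | right].
by apply: le_lebesgue_outer; exact: subIsetl.
Qed.

End lebesgue_outer.

(** * Covers of B and segments in B *)

Section B4.
Variables (R : realType).

Lemma B4P (d : nat) (x : 'rV[R]_(d + 1)) : B4 x ->
  exists h : R, [/\ 0 <= h <= 1, x 0 (rshift d 0) = h &
    forall i : 'I_d, slice h (x 0 (lshift 1 i))].
Proof.
move=> [z [z' [h [[u uE <-] [u' u'E <-] h01 ->]]]]; exists h; split => //.
  by rewrite mxE 2![(_ *: row_mx _ _) _ _]mxE !row_mxEr !mxE; ring.
move=> i; rewrite mxE 2![(_ *: row_mx _ _) _ _]mxE !row_mxEl.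
by have [e eE <-] := u'E i; exists (u 0 i), e.
Qed.

(* One slice coordinate already has measure zero; the others only need to be
   bounded. *)
Lemma B4_finite_box_cover (d : nat) (e : R) : 0 < e ->
  finite_box_cover (@B4 R d.+1) e.
Proof.
move=> e0; have [s [sP sc se]] := rect_cover_null e0.
pose f (r : R * R * (R * R)) : 'rV[R]_(d.+1 + 1) * 'rV[R]_(d.+1 + 1) :=
  (row_mx (\row_(j < d.+1) (if j == 0 then r.1.1 else 0)) (const_mx r.2.1),
   row_mx (\row_(j < d.+1) (if j == 0 then r.1.2 else 1)) (const_mx r.2.2)).
exists (map f s); split.
- move=> _ i /mapP[r /(allP sP)/andP[r1 r2] ->].
  rewrite -(fintype.splitK i) /f/= !mxE fintype.unsplitK.
  by case: (fintype.split i) => j /=; rewrite !mxE//; case: ifP.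
- move=> x /B4P[h [h01 xh xs]].
  have [r rs /andP[r1 r2]] := sc h _ h01 (xs ord0).
  exists (f r); first exact: map_f.
  move=> i; rewrite /f /= -(fintype.splitK i) !mxE fintype.unsplitK.
  case: (fintype.split i) => j /=; rewrite !mxE; last by rewrite (ord1 j) xh.
  by case: eqP => [->//|_]; apply: slice_bounds (xs j).
- rewrite big_map; apply: le_trans se; rewrite le_eqVlt; apply/orP; left.
  apply/eqP/eq_bigr => r _.
  rewrite /box_volume big_split_ord/= big_ord_recl big_ord1.
  rewrite !row_mxEl !row_mxEr !mxE /= big1 ?mulr1// => i _.
  by rewrite !row_mxEl !mxE /= subr0.
Qed.

(** After division by the last coordinate, each other coordinate lies in [-1/3, 1/3] and equals 2 b
    - a with a, b in E; the a's and the 2 b's are the endpoints of a segment parallel to [v] from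
    height 0 to height 1. *)
Lemma B4_segment (d : nat) (v : 'rV[R]_(d + 1)) : 0 < v 0 (rshift d 0) ->
  (forall i : 'I_d, `|v 0 (lshift 1 i)| <= v 0 (rshift d 0) / 3) ->
  contains_segment (@B4 R d) v.
Proof.
set w := v 0 (rshift d 0) => w0 vw.
have /choice[uv uvP] : forall i : 'I_d, exists p : R * R,
    [/\ E4 p.1, E4 p.2 & v 0 (lshift 1 i) / w = 2 * p.2 - p.1].
  move=> i; have [|u [u' [? ? ?]]] := @two_E4_minus_E4 R (v 0 (lshift 1 i) / w).
    have := vw i; rewrite ler_norml => /andP[v1 v2].
    by rewrite ler_pdivlMr// ler_pdivrMr//; lra.
  by exists (u, u').
pose z := row_mx (\row_i (uv i).1) (const_mx 0 : 'rV[R]_1).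
pose z' := row_mx (\row_i (2 * (uv i).2)) (const_mx 1 : 'rV[R]_1).
exists z, w^-1; split; first by rewrite invr_gt0.
move=> t /andP[t0 tw]; exists z, z', (t * w); split.
- exists (\row_i (uv i).1) => // i; rewrite mxE; by have [] := uvP i.
- exists (\row_i (2 * (uv i).2)) => // i; rewrite mxE.
  by exists (uv i).2 => //; have [] := uvP i.
- rewrite mulr_ge0 ?(ltW w0)//=.
  by rewrite -(mulVf (lt0r_neq0 w0)) ler_wpM2r// ltW.
- apply/rowP => i; rewrite -(fintype.splitK i) !mxE fintype.unsplitK.
  case: (fintype.split i) => j /=; rewrite !mxE; last first.
    by rewrite (ord1 j) -/w; ring.
  have [_ _] := uvP j; move/(canRL (mulfVK (lt0r_neq0 w0))) => ->; ring.
Qed.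

End B4.

Theorem mainTheorem5 (R : realType) (d : nat) (hd : (1 <= d)%N) :
  besicovitch_wide (@B4 R d).
Proof.
split.
  case: d hd => // d _; apply: lebesgue_null_finite; first by rewrite addn1.
  exact: B4_finite_box_cover.
pose k := rshift d (0 : 'I_1).
pose a : 'rV[R]_(d + 1) := delta_mx 0 k.
have b0 : (0 : R) < 5^-1 by lra.
(* In the sup norm ball of radius 1/5 about [a], the last coordinate exceeds 4/5 and the others are
   below 1/5 < 4/15 in absolute value. *)
exists (ball a 5^-1 `&` @unit_sphere R (d + 1)); split.
- by exists (ball a 5^-1) => //; exact: ball_open.
- exists a; split; first exact: ballxx.
  rewrite /unit_sphere/= (bigD1 k)//= big1 => [|i ik].
    by rewrite !mxE !eqxx expr1n addr0.
  by rewrite mxE (negPf ik) andbF expr0n.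
- move=> v [[_ va] _].
  have vk : `|1 - v 0 k| < 5^-1.
    by have := va 0 k; rewrite /ball/= mxE !eqxx.
  have vi i : `|v 0 (lshift 1 i)| < 5^-1.
    have := va 0 (lshift 1 i); rewrite /ball/= mxE eqxx/=.
    by rewrite eq_lrshift sub0r normrN.
  move: vk; rewrite ltr_norml => vk.
  apply: B4_segment => [|i]; rewrite -/k; first by lra.
  by have := vi i; rewrite -/k; lra.
Qed.
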